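(* Let $G$ be a graph having the strong Havel--Hakimi property. Then $R(G)=\alpha(G)$, where $R(G)$ is the residue of $G$ and $\alpha(G)$ is the independence number of $G$. Hence every application of the Maxine heuristic to $G$ (with any choices of maximum-degree vertices) produces a maximum independent set of $G$.
   Context: All graphs are finite and simple. A vertex $v$ of a graph $G$ has the Havel--Hakimi property (in $G$) if $v$ has maximum degree in $G$ and no vertex adjacent to $v$ has degree smaller than that of some vertex not adjacent to $v$; that is, $d_G(w)\ge d_G(u)$ for every neighbor $w$ of $v$ and every vertex $u\neq v$ not adjacent to $v$. A graph $G$ has the strong Havel--Hakimi property if in every induced subgraph $H$ of $G$, every vertex of maximum degree in $H$ has the Havel--Hakimi property in $H$. The Havel--Hakimi algorithm, applied to the degree sequence $d$ of a graph, iteratively removes a largest term $t$ from the current sequence and subtracts 1 from each of the $t$ largest remaining terms, re-sorting the terms from largest to smallest after each step, and stops when a list of zeroes is produced (for the degree sequence of a graph this always happens). The residue $R(d)$ is the number of zeroes in the final list; for a graph $G$ with degree sequence $d$, $R(G)=R(d)$. The Maxine heuristic, applied to a graph $G$: as long as the current graph contains at least one edge, choose a vertex of maximum degree in the current graph (arbitrarily if there are several) and delete it. The set of vertices remaining when no edges are left is an independent set of $G$, and is the set produced by the heuristic. *)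

(* Defs.v *)
(* A simple graph is a symmetric irreflexive [e : rel T] on a
   finType [T]; its induced subgraphs are given by their vertex sets
   [S : {set T}], and [S = setT] is the whole graph. *)
From mathcomp Require Import all_boot.

Set Implicit Arguments.
Unset Strict Implicit.
Unset Printing Implicit Defensive.

Section Graph.
Variables (T : finType) (e : rel T).
Implicit Types (S I : {set T}) (u v w : T).

(* Degree of v in the subgraph induced by S (meaningful for v \in S). *)
Definition deg S v : nat := #|[set w in S | e v w]|.

Definition max_degree_vertex S v : Prop :=
  v \in S /\ forall u, u \in S -> deg S u <= deg S v.

Definition HH_property S v : Prop :=
  max_degree_vertex S v /\
  forall w u, w \in S -> u \in S ->
    e v w -> u != v -> ~~ e v u -> deg S u <= deg S w.

Definition strong_HH_property : Prop :=
  forall S v, max_degree_vertex S v -> HH_property S v.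

Definition independent S : bool :=
  [forall x in S, forall y in S, ~~ e x y].

Definition independence_number : nat :=
  \max_(S : {set T} | independent S) #|S|.

Definition maximum_independent S : Prop :=
  independent S /\ #|S| = independence_number.

Definition has_edge S : bool := [exists x in S, exists y in S, e x y].

(* [maxine S I]: some run of the heuristic on the subgraph induced by S
   produces I. *)
Inductive maxine : {set T} -> {set T} -> Prop :=
| maxine_stop S : ~~ has_edge S -> maxine S S
| maxine_delete S v I :
    has_edge S -> max_degree_vertex S v -> maxine (S :\ v) I -> maxine S I.

Definition degree_sequence : seq nat := [seq deg [set: T] v | v <- enum T].

End Graph.

(* Meant for nonincreasing s. On degree sequences of graphs at least t of the
   remaining terms are positive, so neither [take] nor [.-1] truncates. *)
Definition hh_step (s : seq nat) : seq nat :=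
  if s is t :: s' then sort geq ([seq x.-1 | x <- take t s'] ++ drop t s')
  else [::].

Definition all_zero (s : seq nat) : bool := all (pred1 0) s.

(* The argument n bounds the number of steps. *)
Fixpoint hh_run (n : nat) (s : seq nat) : seq nat :=
  if all_zero s then s else
  if n is n'.+1 then hh_run n' (hh_step s) else s.

(* A step shortens the list by one, so [size d] steps always suffice. *)
Definition hh_final (d : seq nat) : seq nat := hh_run (size d) (sort geq d).

Lemma size_hh_step s : size (hh_step s) = (size s).-1.
Proof.
case: s => [|t s] //=.
by rewrite size_sort size_cat size_map -size_cat cat_take_drop.
Qed.

Lemma hh_final_all_zero d : all_zero (hh_final d).
Proof.
rewrite /hh_final; have: size (sort geq d) <= size d by rewrite size_sort.
move: (size d) (sort geq d) => n; elim: n => [|n IHn] s /=.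
  by rewrite leqn0 => /nilP ->.
move=> le_sn; case: ifP => // _; apply: IHn.
by rewrite size_hh_step; case: (size s) le_sn.
Qed.

Definition residue (d : seq nat) : nat := count_mem 0 (hh_final d).

(* Main.v *)
(** Deleting a vertex with the Havel--Hakimi property acts on the degree
    sequence as one step of the Havel--Hakimi algorithm, so every Maxine run on
    [G] ends with exactly [R(G)] vertices. It remains to see that some
    maximum-degree vertex can be deleted without decreasing the independence
    number. Suppose that an independent set [I] contains all maximum-degree
    vertices, and let [v] be one of them. Unless [v] can be exchanged in [I] for
    some neighbor, every neighbor of [v] has another neighbor in [I]; looking at
    five-vertex induced subgraphs, nonadjacent neighbors of [v] then have the
    same neighbors in [I]. A neighbor [a] of [v] has smaller degree than [v], so
    some distinct neighbors [b], [c] of [v] are nonadjacent to [a]; with [x] in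
    [I] a common neighbor of [a], [b], [c], the vertex [v] violates the
    Havel--Hakimi property in the subgraph induced by [v], [x], [a], [b], [c]. *)
Require Import Defs.
From mathcomp Require Import all_boot.

Set Implicit Arguments.
Unset Strict Implicit.
Unset Printing Implicit Defensive.

(** * Nonincreasing lists and the Havel--Hakimi step *)

Lemma geq_total : total geq.
Proof. by move=> m n; apply: leq_total. Qed.

Lemma geq_trans : transitive geq.
Proof. by move=> n m p le_nm le_pn; apply: leq_trans le_pn le_nm. Qed.

Lemma geq_anti : antisymmetric geq.
Proof. by move=> m n /=; rewrite andbC -eqn_leq => /eqP. Qed.

Lemma sort_geq_perm (s1 s2 : seq nat) :
  perm_eq s1 s2 -> sort geq s1 = sort geq s2.
Proof. by move/(perm_sortP geq_total geq_trans geq_anti). Qed.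

Lemma sort_geq_cat (s1 s2 : seq nat) : allrel geq s1 s2 ->
  sort geq (s1 ++ s2) = sort geq s1 ++ sort geq s2.
Proof.
move=> ge_s12; apply: (sorted_eq geq_trans geq_anti).
- exact: (sort_sorted geq_total).
- rewrite (sorted_pairwise geq_trans) pairwise_cat -!(sorted_pairwise geq_trans).
  rewrite !(sort_sorted geq_total) !andbT.
  by rewrite (eq_allrel_meml _ _ (mem_sort _ _)) (eq_allrel_memr _ _ (mem_sort _ _)).
- by rewrite perm_sort perm_sym; apply: perm_cat; rewrite perm_sort.
Qed.

(** Sorting puts [size s1] first and all of [s1] before [s2], so the terms that get decremented are
    those of [s1]; ties with [s2] do not affect the values. *)
Lemma hh_step_cat (s1 s2 : seq nat) : allrel geq s1 s2 ->
    all (geq (size s1)) (s1 ++ s2) ->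
  hh_step (sort geq (size s1 :: s1 ++ s2)) = sort geq (map predn s1 ++ s2).
Proof.
move=> ge_s12 ge_s; rewrite -cat1s sort_geq_cat ?allrel1l //=.
rewrite (sort_geq_cat ge_s12) take_size_cat ?size_sort // drop_size_cat ?size_sort //.
by apply: sort_geq_perm; apply: perm_cat; rewrite ?perm_map ?perm_sort.
Qed.

Section Graph.
Variables (T : finType) (e : rel T).
Hypotheses (e_sym : symmetric e) (e_irr : irreflexive e).
Implicit Types (S I J : {set T}) (u v w : T).

(** * Independent sets and degrees in induced subgraphs *)

Lemma independentP I : reflect {in I &, forall x y, ~~ e x y} (independent e I).
Proof.
apply: (iffP forall_inP) => [indI x y Ix Iy|indI x Ix].
  by have /forall_inP := indI x Ix; apply.
by apply/forall_inP => y Iy; apply: indI.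
Qed.

Lemma independent_has_edge S : independent e S = ~~ has_edge e S.
Proof.
apply/independentP/idP => [indS|noE x y Sx Sy].
  by apply/existsP=> -[x /andP[Sx /existsP[y /andP[Sy]]]]; apply/negP/indS.
apply: contra noE => exy; apply/existsP; exists x; rewrite Sx /=.
by apply/existsP; exists y; rewrite Sy.
Qed.

Lemma independent_exchange I v w : independent e I ->
    {in I :\ v, forall x, ~~ e w x} -> independent e (w |: (I :\ v)).
Proof.
move=> /independentP indI nw; apply/independentP => x y.
rewrite !in_setU1 => /predU1P[->|Ix] /predU1P[->|Iy].
- by rewrite e_irr.
- exact: nw.
- by rewrite e_sym nw.
- by apply: indI; [have /setD1P[] := Ix | have /setD1P[] := Iy].
Qed.

Lemma deg_gt0 S v w : w \in S -> e v w -> 0 < deg e S v.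
Proof. by move=> Sw evw; apply/card_gt0P; exists w; rewrite inE Sw. Qed.

Lemma deg_seq (s : seq T) v : uniq s -> deg e [set x in s] v = count (e v) s.
Proof.
move=> uniq_s; rewrite -size_filter -(card_uniqP (filter_uniq _ uniq_s)).
by apply: eq_card => x; rewrite !inE mem_filter andbC.
Qed.

Lemma deg_setD1 S v u : v \in S -> deg e (S :\ v) u = deg e S u - e u v.
Proof.
move=> Sv; rewrite [deg e S u](cardsD1 v) inE Sv /= addKn; apply: eq_card => x.
by rewrite !inE andbA.
Qed.

Lemma max_degree_vertex_exists S :
  S != set0 -> exists v, max_degree_vertex e S v.
Proof.
case/set0Pn=> v0 Sv0; have [v Sv maxv] := arg_maxnP (deg e S) Sv0.
by exists v.
Qed.

Lemma has_edge_neq0 S : has_edge e S -> S != set0.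
Proof. by case/existsP=> x /andP[Sx _]; apply/set0Pn; exists x. Qed.

Lemma max_degree_gt0 S v :
  has_edge e S -> max_degree_vertex e S v -> 0 < deg e S v.
Proof.
case/existsP=> x /andP[Sx /existsP[y /andP[Sy exy]]] [_ maxv].
exact: leq_trans (deg_gt0 Sy exy) (maxv x Sx).
Qed.

(** * Vertex deletion as a Havel--Hakimi step *)

Definition sorted_degrees S : seq nat :=
  sort geq [seq deg e S x | x <- enum S].

(** The degrees of the neighbors of [v] form [s1] and those of the other vertices form [s2]. The
    Havel--Hakimi property is what [hh_step_cat] needs, and losing [v] lowers exactly the degrees in
    [s1]. *)
Lemma hh_step_delete S v : HH_property e S v ->
  hh_step (sorted_degrees S) = sorted_degrees (S :\ v).
Proof.
case=> -[Sv maxv] HHv; pose r := enum (S :\ v).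
have rE x : (x \in r) = (x != v) && (x \in S) by rewrite mem_enum !inE.
pose s1 := [seq deg e S x | x <- r & e v x].
pose s2 := [seq deg e S x | x <- r & ~~ e v x].
have size_s1 : size s1 = deg e S v.
  rewrite size_map -(card_uniqP (filter_uniq _ (enum_uniq _))).
  apply: eq_card => x; rewrite inE mem_filter rE.
  by case: eqP => [->|]; rewrite ?e_irr ?andbF //= andbC.
have perm_r : perm_eq r ([seq x <- r | e v x] ++ [seq x <- r | ~~ e v x]).
  by rewrite perm_sym; apply/permPl/perm_filterC.
have perm_S : perm_eq [seq deg e S x | x <- enum S] (size s1 :: s1 ++ s2).
  rewrite size_s1 -map_cat -(map_cons (deg e S)); apply: perm_map.
  apply: (@perm_trans _ (v :: r)); last by rewrite perm_cons.
  apply: uniq_perm; rewrite ?enum_uniq //= ?enum_uniq ?rE ?eqxx //.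
  by move=> x; rewrite mem_enum inE rE; case: eqP => [->|].
rewrite /sorted_degrees (sort_geq_perm perm_S) hh_step_cat.
- apply: sort_geq_perm; rewrite perm_sym.
  apply: perm_trans (perm_map _ perm_r) _; rewrite map_cat.
  apply/permP => p; congr (count p (_ ++ _)); rewrite -?map_comp;
    apply/eq_in_map => x.
    by rewrite mem_filter => /andP[evx _] /=; rewrite deg_setD1 // e_sym evx subn1.
  by rewrite mem_filter => /andP[nvx _] /=; rewrite deg_setD1 // e_sym (negPf nvx) subn0.
- apply/allrelP=> _ _ /mapP[w + ->] /mapP[u + ->].
  rewrite mem_filter rE => /and3P[evw _ Sw].
  by rewrite mem_filter rE => /and3P[nvu u_neq_v Su]; apply: HHv.
- rewrite size_s1 -map_cat; apply/allP=> _ /mapP[u + ->].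
  by rewrite -(perm_mem perm_r) rE => /andP[_ /maxv].
Qed.

Lemma all_zero_sorted_degrees S :
  all_zero (sorted_degrees S) = ~~ has_edge e S.
Proof.
rewrite /all_zero all_sort -independent_has_edge.
apply/allP/independentP => [deg0 x y Sx Sy|indS _ /mapP[x + ->]].
  have /eqP : deg e S x == 0 by apply: deg0; rewrite map_f ?mem_enum.
  by apply: contra_eqN => exy; rewrite -lt0n (deg_gt0 Sy).
rewrite mem_enum => Sx /=; rewrite cards_eq0; apply/eqP/setP=> y.
by rewrite !inE; apply/andP=> -[Sy]; apply/negP/indS.
Qed.

(** The step bound is the length of the list, so deleting a vertex uses up exactly one step. *)
Definition set_residue S : nat := count_mem 0 (hh_run #|S| (sorted_degrees S)).

Lemma set_residue_edgeless S : ~~ has_edge e S -> set_residue S = #|S|.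
Proof.
rewrite -all_zero_sorted_degrees /set_residue => zS.
have -> : hh_run #|S| (sorted_degrees S) = sorted_degrees S.
  by case: #|S| => [|n] /=; rewrite zS.
by move: zS; rewrite /all_zero all_count => /eqP->; rewrite size_sort size_map -cardE.
Qed.

Lemma set_residue_delete S v : has_edge e S -> HH_property e S v ->
  set_residue (S :\ v) = set_residue S.
Proof.
move=> edgeS HHv; have [[Sv _] _] := HHv.
rewrite /set_residue (cardsD1 v S) Sv /= all_zero_sorted_degrees edgeS /=.
by rewrite (hh_step_delete HHv).
Qed.

Lemma residue_setT : residue (degree_sequence e) = set_residue [set: T].
Proof.
rewrite /residue /hh_final /set_residue /sorted_degrees /degree_sequence.
by rewrite enum_setT -enumT size_map -cardE cardsT.
Qed.

(** * Five-vertex obstructions and the exchange argument *)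

Hypothesis strong_HH : strong_HH_property e.

(** On an explicit list of vertices the degrees become counts that simplification evaluates, so
    small obstructions can be checked by computation. *)
Lemma strong_HH_seq (s : seq T) v w u :
    uniq s -> v \in s -> w \in s -> u \in s ->
    all (fun x => count (e x) s <= count (e v) s) s ->
    e v w -> u != v -> ~~ e v u ->
  count (e u) s <= count (e w) s.
Proof.
move=> uniq_s sv sw su /allP maxv evw u_neq_v nvu; rewrite -!deg_seq //.
have [|_ HHv] := @strong_HH [set x in s] v; last by apply: HHv; rewrite ?inE.
by split=> [|x]; rewrite inE // => sx; rewrite !deg_seq // maxv.
Qed.

(** If [b] missed [x], then among [a], [b], [v], [x], [z] the vertex [a] would have maximum degree,
    a neighbor [x] of degree 1 and a nonneighbor [b] of degree 2. *)
Lemma common_neighbor I v a b x z : independent e I ->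
    v \in I -> x \in I :\ v -> z \in I :\ v ->
    e v a -> e v b -> ~~ e a b -> e a x -> e b z ->
  e b x.
Proof.
move=> /independentP indI Iv /setD1P[xv Ix] /setD1P[zv Iz] eva evb nab eax ebz.
apply: contraT => nbx.
have [nvx nvz nxz] : [/\ e v x = false, e v z = false & e x z = false].
  by split; apply/negbTE/indI.
have neqI y u t : y \in I -> t \in I -> e t u -> (y == u) = false.
  by move=> Iy It etu; apply: contraTF etu => /eqP <-; apply: indI.
have [va vb] : (v == a) = false /\ (v == b) = false by split; apply: (neqI _ _ v).
have [xa xb] : (x == a) = false /\ (x == b) = false by split; apply: (neqI _ _ v).
have [za zb] : (z == a) = false /\ (z == b) = false by split; apply: (neqI _ _ v).
have ab : (a == b) = false by apply: contraNF nbx => /eqP <-.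
have xz : (x == z) = false by apply: contraNF nbx => /eqP ->.
have adjE := (e_irr, eva, evb, negbTE nab, eax, ebz, negbTE nbx, nvx, nvz, nxz,
  e_sym a v, e_sym b v, e_sym b a, e_sym x a, e_sym x b, e_sym x v, e_sym z a,
  e_sym z b, e_sym z v, e_sym z x).
have := @strong_HH_seq [:: a; b; v; x; z] a x b.
rewrite /= !inE !eqxx !orbT ab (eq_sym a) va (eq_sym a) xa (eq_sym a) za.
rewrite (eq_sym b v) vb (eq_sym b x) xb (eq_sym b z) zb !(eq_sym v) (negPf xv).
rewrite (negPf zv) xz (eq_sym b a) ab /= !adjE.
(* Only the pair [a], [z] is undetermined: the subgraph is the path [x a v b z] or the four-cycle
   [a v b z] with [x] pendant at [a]. *)
by case: (e a z) => /= H; have := H isT isT isT isT isT isT isT isT.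
Qed.

Lemma two_nonadjacent_neighbors S v a x :
    v \in S -> a \in S -> x \in S -> e v a -> e a x -> ~~ e v x -> x != v ->
    deg e S a < deg e S v ->
  exists b c, [/\ b != c, e v b, e v c, ~~ e a b & ~~ e a c] /\
              [/\ b != a, c != a, b \in S & c \in S].
Proof.
move=> Sv Sa Sx eva eax nvx xv lt_av.
pose N u := [set w in S | e u w].
pose Q := N v :\: N a :\ a.
(* Both [v] and [x] lie in [N a :\: N v], and [N v] is larger than [N a]; hence [N v :\: N a] has at
   least three elements, one of which is [a]. *)
have lt1Q : 1 < #|Q|.
  have aNN : a \in N v :\: N a by rewrite !inE Sa eva e_irr.
  have vNN : v \in N a :\: N v by rewrite !inE Sv e_irr e_sym eva.
  have xNN : x \in (N a :\: N v) :\ v by rewrite !inE xv Sx eax nvx.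
  move: lt_av; rewrite /deg -/(N a) -/(N v) -(cardsID (N v) (N a)).
  rewrite -(cardsID (N a) (N v)) setIC ltn_add2l.
  rewrite (cardsD1 v) vNN (cardsD1 x) xNN (cardsD1 a (N v :\: N a)) aNN.
  by rewrite !add1n ltnS; apply: leq_trans.
have /card_gt1P[b [c [Qb Qc bc]]] := lt1Q.
exists b, c; move: Qb Qc; rewrite !inE.
case/and3P=> ba nab /andP[Sb evb] /and3P[ca nac /andP[Sc evc]].
by rewrite Sb /= in nab; rewrite Sc /= in nac.
Qed.

(** The vertex [a] obtained here can replace [v] in [I]. *)
Lemma neighbor_exchange S I v : v \in S -> v \in I -> I \subset S ->
    independent e I -> 0 < deg e S v ->
    {in S, forall w, e v w -> deg e S w < deg e S v} ->
  exists2 a, (a \in S) && e v a & {in I :\ v, forall x, ~~ e a x}.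
Proof.
move=> Sv Iv sIS indI /card_gt0P[a]; rewrite inE => /andP[Sa eva] ltdeg.
have [/exists_inP[w]|] :=
  boolP [exists (w | (w \in S) && e v w), [forall x in I :\ v, ~~ e w x]].
  by move=> Sw /forall_inP; exists w.
rewrite negb_exists_in => /forall_inP nexch.
have other w : w \in S -> e v w -> exists2 x, x \in I :\ v & e w x.
  move=> Sw evw; have := nexch w; rewrite Sw evw => /(_ isT).
  by rewrite negb_forall_in => /exists_inP[x Ix /negPn]; exists x.
have [x Ix eax] := other a Sa eva; have /setD1P[xv Ix'] := Ix.
have nvx : ~~ e v x by have /independentP := indI; apply.
have [b [c [[bc evb evc nab nac] [ba ca Sb Sc]]]] :=
  two_nonadjacent_neighbors Sv Sa (subsetP sIS x Ix') eva eax nvx xv (ltdeg a Sa eva).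
have ebx : e b x.
  have [z Iz ebz] := other b Sb evb.
  exact: common_neighbor indI Iv Ix Iz eva evb nab eax ebz.
have ecx : e c x.
  have [z Iz ecz] := other c Sc evc.
  exact: common_neighbor indI Iv Ix Iz eva evc nac eax ecz.
have neq u w : e u w -> (u == w) = false.
  by apply: contraTF => /eqP ->; rewrite e_irr.
have adjE := (e_irr, eva, evb, evc, negbTE nab, negbTE nac, eax, ebx, ecx,
  negbTE nvx, e_sym a v, e_sym b v, e_sym c v, e_sym x v, e_sym x a, e_sym x b,
  e_sym x c, e_sym b a, e_sym c a, e_sym c b).
(* The subgraph is complete bipartite between [v], [x] and [a], [b], [c], possibly with the edge
   [b c] added. Here [v] has the maximum degree 3, its neighbor [a] has degree 2, and its
   nonneighbor [x] has degree 3. *)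
have := @strong_HH_seq [:: v; x; a; b; c] v a x.
rewrite /= !inE !eqxx !orbT (neq _ _ eva) (neq _ _ evb) (neq _ _ evc).
rewrite xv (eq_sym v) (negPf xv) !(eq_sym x) (neq _ _ eax) (neq _ _ ebx).
rewrite (neq _ _ ecx) !(eq_sym a) (negPf ba) (negPf ca) (negPf bc) /= !adjE.
by case: (e b c) => /= H; have := H isT isT isT isT isT isT isT isT.
Qed.

(** A maximum-degree vertex outside [I] allows [J] to be [I] itself; if there is none, [J] comes
    from an exchange. *)
Lemma independent_avoiding_max S I : has_edge e S -> I \subset S ->
    independent e I ->
  exists v J, [/\ max_degree_vertex e S v, J \subset S :\ v,
                  independent e J & #|J| = #|I|].
Proof.
move=> edgeS sIS indI.
have [v maxv] := max_degree_vertex_exists (has_edge_neq0 edgeS).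
have [Sv le_v] := maxv.
have [/exists_inP[u Su /andP[/eqP eq_uv nIu]]|] :=
  boolP [exists u in S, (deg e S u == deg e S v) && (u \notin I)].
  exists u, I; split=> //; last by rewrite subsetD1 sIS.
  by split=> // w Sw; rewrite eq_uv le_v.
rewrite negb_exists_in => /forall_inP allI.
have Iv : v \in I by have := allI v Sv; rewrite eqxx negbK.
have [|w Sw evw|a /andP[Sa eva] nIa] := neighbor_exchange Sv Iv sIS indI.
- exact: max_degree_gt0.
- rewrite ltn_neqAle le_v // andbT; apply: contraL evw => eq_wv.
  have := allI w Sw; rewrite eq_wv negbK => Iw.
  by have /independentP := indI; apply.
exists v, (a |: (I :\ v)); split=> //.
- rewrite subUset setSD // sub1set !inE Sa andbT.
  by rewrite andbT; apply: contraTneq eva => ->; rewrite e_irr.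
- exact: independent_exchange.
- rewrite cardsU1 (cardsD1 v I) Iv; congr (nat_of_bool _ + _).
  rewrite !inE negb_and; apply/orP; right; apply: contraL eva => Ia.
  by have /independentP := indI; apply.
Qed.

(** * Residue, independence number and Maxine runs *)

Lemma independent_le_residue S I : I \subset S -> independent e I ->
  #|I| <= set_residue S.
Proof.
have [n] := ubnP #|S|; elim: n S I => // n IHn S I leSn sIS indI.
have [edgeS|noE] := boolP (has_edge e S); last first.
  by rewrite set_residue_edgeless // subset_leq_card.
have [v [J [maxv sJS indJ <-]]] := independent_avoiding_max edgeS sIS indI.
(* The deletion of [v] keeps the residue, so the induction hypothesis for [J] in [S :\ v] gives the
   bound. *)
rewrite -(set_residue_delete edgeS (strong_HH maxv)) IHn //.
by move: leSn; rewrite (cardsD1 v S); have [-> _] := maxv.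
Qed.

(** The residue is constant along a run and, once no edges are left, counts the remaining
    vertices. *)
Lemma maxine_residue S I : maxine e S I ->
  independent e I /\ #|I| = set_residue S.
Proof.
elim=> {S I} [S noE|S v I edgeS maxv _ [indI ->]].
  by rewrite independent_has_edge set_residue_edgeless.
by rewrite set_residue_delete //; apply: strong_HH.
Qed.

Lemma maxine_exists S : exists I, maxine e S I.
Proof.
have [n] := ubnP #|S|; elim: n S => // n IHn S leSn.
have [edgeS|noE] := boolP (has_edge e S); last by exists S; apply: maxine_stop.
have [v maxv] := max_degree_vertex_exists (has_edge_neq0 edgeS).
have [|I runI] := IHn (S :\ v).
  by move: leSn; rewrite (cardsD1 v S); have [-> _] := maxv.
by exists I; apply: maxine_delete runI.
Qed.

Lemma residue_independence_number :
  residue (degree_sequence e) = independence_number e.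
Proof.
rewrite residue_setT; apply/eqP; rewrite eqn_leq; apply/andP; split.
  (* Any single run provides an independent set whose size is the residue. *)
  have [I /maxine_residue[indI <-]] := maxine_exists [set: T].
  exact: (bigmax_sup I).
by apply/bigmax_leqP=> I indI; apply: independent_le_residue; rewrite ?subsetT.
Qed.

End Graph.

Theorem theorem5 (T : finType) (e : rel T)
    (e_sym : symmetric e) (e_irr : irreflexive e)
    (strong_HH : strong_HH_property e) :
  residue (degree_sequence e) = independence_number e /\
  (forall I : {set T}, maxine e [set: T] I -> maximum_independent e I).
Proof.
have resE := residue_independence_number e_sym e_irr strong_HH.
split=> // I /(maxine_residue e_sym e_irr strong_HH)[indI cardI].
by split; rewrite // -resE residue_setT.
Qed.
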